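(* Let $T>0$. For every $f\in\mathcal{M}_T^{\mathrm{Euler}}$ there exists a constant $C_f$, independent of $n\in\mathbb{N}$ and $\Delta t>0$, such that for all $n\in\mathbb{N}$ and $\Delta t>0$ with $n\Delta t\le T$, $$\lVert P_{n\Delta t}f-(Q^{\mathrm{Euler}}_{(\Delta t)})^nf\rVert_{\psi_{\ell_0,s_0}}\le C_f\,\Delta t.$$
   Context: Setting. $X$ is a separable Hilbert space with norm $\lVert\cdot\rVert$; $A$ with domain $\operatorname{dom}A$ generates a strongly continuous pseudocontractive semigroup on $X$ (i.e. $\lVert e^{tA}\rVert\le e^{ct}$ for some $c\in\mathbb{R}$) and has compact resolvent. $\operatorname{dom}A^{\ell}$ is a Hilbert space with norm $\lVert x\rVert_{\operatorname{dom}A^{\ell}}:=(\sum_{k=0}^{\ell}\lVert A^kx\rVert^2)^{1/2}$ ($\operatorname{dom}A^0=X$). Let $m\ge 1$; $\alpha,\sigma_1,\dots,\sigma_d\colon X\to X$ are Lipschitz continuous on $X$ and also Lipschitz continuous $\operatorname{dom}A^{\ell}\to\operatorname{dom}A^{\ell}$ for $\ell=1,\dots,m$; the $\sigma_j$ are continuously differentiable with bounded first derivative. $(W^j_t)_{j=1,\dots,d}$ is a $d$-dimensional Brownian motion. $x(t,x_0)$ is the (mild) solution of $\mathrm{d}x(t,x_0)=(Ax(t,x_0)+\alpha(x(t,x_0)))\,\mathrm{d}t+\sum_{j=1}^d\sigma_j(x(t,x_0))\,\mathrm{d}W^j_t$, $x(0,x_0)=x_0$, and $P_tf(x_0):=\mathbb{E}[f(x(t,x_0))]$.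 With $\alpha_0(z):=\alpha(z)-\frac12\sum_{j=1}^dD\sigma_j(z)\sigma_j(z)$, $z^0(t,x_0)$ is the solution of $\frac{\mathrm{d}}{\mathrm{d}t}z^0=Az^0+\alpha_0(z^0)$, and for $j=1,\dots,d$, $z^j(t,x_0)$ solves the Stratonovich equation $\mathrm{d}z^j=\sigma_j(z^j)\circ\mathrm{d}W^j_t$, all started at $x_0$; $P^j_tf(x_0):=\mathbb{E}[f(z^j(t,x_0))]$, $j=0,\dots,d$. Function spaces. For $\ell\ge 0$, $s\ge 2$ let $\psi_{\ell,s}(x):=(1+\lVert x\rVert_{\operatorname{dom}A^{\ell}}^2)^{s/2}$ on $\operatorname{dom}A^{\ell}$. $(\operatorname{dom}A^{\ell})_w$ is $\operatorname{dom}A^{\ell}$ with its weak topology, and $\mathcal{B}^{\psi_{\ell,s}}((\operatorname{dom}A^{\ell})_w)$ is the closure of the bounded weakly continuous functions $\operatorname{dom}A^{\ell}\to\mathbb{R}$ with respect to $\lVert f\rVert_{\psi_{\ell,s}}:=\sup_x\psi_{\ell,s}(x)^{-1}|f(x)|$. Fix $\ell_0\in\{0,\dots,m-1\}$ and $s_0\ge 2$. $(P_t)$ and $(P^j_t)$, $j=0,\dots,d$, are regarded as strongly continuous semigroups on $\mathcal{B}^{\psi_{\ell_0,s_0}}((\operatorname{dom}A^{\ell_0})_w)$ with operator norms bounded by $e^{\omega t}$, $e^{\omega_jt}$ for some real constants (standing assumption). Their infinitesimal generators on this space are $\mathcal{G}$ and $\mathcal{G}_j$. The Euler splitting is $Q^{\mathrm{Euler}}_{(\Delta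 t)}:=P^0_{\Delta t}P^1_{\Delta t}\cdots P^d_{\Delta t}$. $\mathcal{M}_T^{\mathrm{Euler}}:=\mathcal{M}_T^2$, where for $q\ge 1$, $\mathcal{M}_T^{q}$ is the set of $f\in\mathcal{B}^{\psi_{\ell_0,s_0}}((\operatorname{dom}A^{\ell_0})_w)$ such that $P_tf\in\operatorname{dom}\mathcal{G}^q\cap\bigcap_{j=0}^d\operatorname{dom}\mathcal{G}_j^q$ for $t\in[0,T]$, $\sup_{t\in[0,T],\,j_1,\dots,j_q\in\{0,\dots,d\}}\lVert\mathcal{G}_{j_1}\cdots\mathcal{G}_{j_q}P_tf\rVert_{\psi_{\ell_0,s_0}}<\infty$ (in particular these compositions are defined), and $\mathcal{G}^iP_tf=(\sum_{j=0}^d\mathcal{G}_j)^iP_tf$ for $i=1,\dots,q$, $t\in[0,T]$. *)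

(* Defs.v *)
From HB Require Import structures.
From mathcomp Require Import all_boot all_order all_algebra.
From mathcomp Require Import all_classical all_reals all_analysis.

Set Implicit Arguments.
Unset Strict Implicit.
Unset Printing Implicit Defensive.

Import Order.TTheory GRing.Theory Num.Theory.
Import numFieldNormedType.Exports.

Local Open Scope classical_set_scope.
Local Open Scope ring_scope.

(* V is a vector space with an extended-real-valued norm, and E the subspace
   of V on which the norm is finite and the semigroup acts. The Hilbert space
   is the case E = setT; the weighted space B^psi is a subspace of D -> R. *)

Section Semigroups.
Variables (R : realType) (V : lmodType R).
Implicit Types (nrm : V -> \bar R) (E : set V) (S : R -> V -> V).

Definition c0_semigroup nrm E S : Prop :=
  (forall t x, 0 <= t -> E x -> E (S t x)) /\
  (forall t (a : R) x y, 0 <= t -> E x -> E y ->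
    S t (a *: x + y) = a *: S t x + S t y) /\
  (forall t, 0 <= t ->
    exists M : R, forall x, E x -> (nrm (S t x) <= M%:E * nrm x)%E) /\
  (forall x, E x -> S 0 x = x) /\
  (forall s t x, 0 <= s -> 0 <= t -> E x -> S (s + t) x = S s (S t x)) /\
  (forall x, E x -> nrm (S h x - x) @[h --> (0 : R)^'+] --> 0%E).

Definition growth_bound nrm E S (w : R) : Prop :=
  forall t x, 0 <= t -> E x -> (nrm (S t x) <= (expR (w * t))%:E * nrm x)%E.

(* The infinitesimal generator, an unbounded operator, given by its graph. *)
Definition generator nrm E S : V -> V -> Prop := fun x y =>
  [/\ E x, E y & nrm (h^-1 *: (S h x - x) - y) @[h --> (0 : R)^'+] --> 0%E].

(* [opcomp [:: G1; ...; Gq] x y] : the composition G1 ... Gq is defined at x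
   and has value y there (Gq is applied first). *)
Fixpoint opcomp (Gs : seq (V -> V -> Prop)) (x y : V) : Prop :=
  if Gs is G :: Gs' then exists2 z, opcomp Gs' x z & G z y else y = x.

Definition oppow (G : V -> V -> Prop) (q : nat) : V -> V -> Prop :=
  opcomp (nseq q G).

(* The sum of unbounded operators, on the intersection of their domains. *)
Definition opsum (k : nat) (G : 'I_k -> V -> V -> Prop) (x y : V) : Prop :=
  exists2 g : 'I_k -> V, forall j, G j x (g j) & y = \sum_(j < k) g j.

End Semigroups.

Section Domains.
Variables (R : realType) (X : completeNormedModType R).
Variables (A : X -> X) (domA : set X).

Definition enorm (x : X) : \bar R := (`|x|)%:E.

(* A is only meaningful on domA; its values elsewhere are irrelevant. *)
Definition generates (S : R -> X -> X) : Prop :=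
  forall x y, (domA x /\ A x = y) <-> generator enorm setT S x y.

Definition compact_resolvent : Prop :=
  exists (lam : R) (Rl : X -> X),
    [/\ forall y, domA (Rl y) /\ lam *: Rl y - A (Rl y) = y,
        forall x, domA x -> Rl (lam *: x - A x) = x &
        compact (closure (Rl @` [set y | `|y| <= 1]))].

Definition domn (l : nat) : set X :=
  [set x | forall k, (k < l)%N -> domA (iter k A x)].

Definition normn (l : nat) (x : X) : R :=
  Num.sqrt (\sum_(k < l.+1) `|iter k A x| ^+ 2).

(* For l = 0 this is Lipschitz continuity on X. *)
Definition lipschitz_domn (l : nat) (f : X -> X) : Prop :=
  (forall x, domn l x -> domn l (f x)) /\
  exists L : R, forall x y, domn l x -> domn l y ->
    normn l (f x - f y) <= L * normn l (x - y).

Section WeightedSpace.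
Variable (l : nat).
Notation D := (set_type (domn l)).

Definition functional (phi : D -> R) : Prop :=
  (forall (a : R) (x y z : D), val z = a *: val x + val y ->
    phi z = a * phi x + phi y) /\
  exists C : R, forall x, `|phi x| <= C * normn l (val x).

Definition weak_eval (x : D) :
    prod_topology (fun _ : {phi : D -> R | functional phi} => R) :=
  fun phi => sval phi x.

(* (dom A^l)_w : the weak topology, initial for all bounded functionals. *)
Definition weak_domn : topologicalType := initial_topology weak_eval.

Definition weakly_continuous (g : weak_domn -> R) : Prop := continuous g.

Definition psi (s : R) (x : D) : R := (1 + normn l (val x) ^+ 2) `^ (s / 2).

Definition psi_norm (s : R) (f : D -> R) : \bar R :=
  ereal_sup [set ((psi s x)^-1 * `|f x|)%:E | x in [set: D]].

Definition Bpsi (s : R) : set (D -> R) :=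
  [set f | forall e : R, 0 < e -> exists g : D -> R,
    [/\ exists M : R, forall x, `|g x| <= M,
        weakly_continuous g & (psi_norm s (f - g)%R < e%:E)%E]].

Definition extend0 (f : D -> R) (y : X) : R := oapp f 0 (insub y).

End WeightedSpace.
End Domains.

Definition separable_space (T : topologicalType) : Prop :=
  exists2 E : set T, countable E & dense E.

Definition C1_bounded_derivative (R : realType) (X : completeNormedModType R)
    (f : X -> X) : Prop :=
  [/\ forall x, differentiable f x,
      exists M : R, forall x h, `|'d f x h| <= M * `|h| &
      forall x (e : R), 0 < e ->
        \forall y \near x, forall h, `|'d f y h - 'd f x h| <= e * `|h|].

Definition strat_drift (R : realType) (X : completeNormedModType R) (d : nat)
    (alpha : X -> X) (sigma : 'I_d -> X -> X) (z : X) : X :=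
  alpha z - 2^-1 *: \sum_(j < d) 'd (sigma j) z (sigma j z).

(* v is the Bochner integral of g over [0, t]: g is approximated in L^1 by
   simple functions whose integrals converge to v. *)
Definition bochner_integral (R : realType) (X : completeNormedModType R)
    (t : R) (g : R -> X) (v : X) : Prop :=
  exists (N : nat -> nat) (B : nat -> nat -> set R) (c : nat -> nat -> X),
    let err n u := `|g u - \sum_(i < N n) (\1_(B n i) u : R) *: c n i| in
    [/\ forall n i, measurable (B n i) /\ B n i `<=` `[0, t],
        forall n, measurable_fun `[0, t] (err n),
        (\int[lebesgue_measure]_(u in `[0%R, t]) (err n u)%:E)%E
          @[n --> \oo] --> 0%E &
        \sum_(i < N n) fine (lebesgue_measure (B n i)) *: c n i
          @[n --> \oo] --> v].

Section Stochastic.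
Variables (R : realType) (dd : measure_display) (Omega : measurableType dd).
Variables (P : probability Omega R) (F : R -> set (set Omega)).

Definition filtration : Prop :=
  (forall t, 0 <= t -> sigma_algebra setT (F t)) /\
  (forall t B, 0 <= t -> F t B -> measurable B) /\
  (forall s t, 0 <= s -> s <= t -> F s `<=` F t).

(* The last clause says at once that the increment over [s, t] is independent
   of F s, that its components are independent, and that each of them has law
   N(0, t - s) (normal_prob takes the standard deviation). *)
Definition brownian_motion (d : nat) (W : 'I_d -> R -> Omega -> R) : Prop :=
  [/\ forall j, {ae P, forall w, W j 0 w = 0},
      forall j t (B : set R), 0 <= t -> measurable B -> F t (W j t @^-1` B),
      forall j, {ae P, forall w, {within `[0, +oo[, continuous (W j ^~ w)}} &
      forall s t G (B : 'I_d -> set R), 0 <= s -> s < t -> F s G ->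
        (forall j, measurable (B j)) ->
        P (G `&` [set w | forall j, B j (W j t w - W j s w)]) =
        (P G * \prod_(j < d) normal_prob 0 (Num.sqrt (t - s)) (B j))%E].

(* Z n tends to 0 in probability; Z n need not be measurable, whence the
   covering sets E n. *)
Definition cvg0_in_probability (Z : nat -> Omega -> \bar R) : Prop :=
  forall e : R, 0 < e -> exists E : nat -> set Omega,
    [/\ forall n, measurable (E n),
        forall n w, (e%:E < Z n w)%E -> E n w &
        P (E n) @[n --> \oo] --> 0%E].

Variable (X : completeNormedModType R).

Definition adapted (Y : R -> Omega -> X) : Prop :=
  forall t U, 0 <= t -> open U -> F t (Y t @^-1` U).

Definition continuous_paths (Y : R -> Omega -> X) : Prop :=
  {ae P, forall w, {within `[0, +oo[, continuous (Y ^~ w)}}.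

(* Y is the Ito integral of Phi over [0, t] with respect to the real Brownian
   motion w: Phi is approximated in L^2(0, t), in probability, by elementary
   processes sum_i xi_i 1_(]a_i, b_i]] (xi_i bounded, F_(a_i)-measurable)
   whose elementary integrals converge to Y in probability. *)
Definition ito_integral (W : R -> Omega -> R) (t : R) (Phi : R -> Omega -> X)
    (Y : Omega -> X) : Prop :=
  exists (N : nat -> nat) (a b : nat -> nat -> R)
         (xi : nat -> nat -> Omega -> X),
    let err n w u := `|Phi u w -
      \sum_(i < N n) (\1_(`]a n i, b n i] : set R) u : R) *: xi n i w| in
    [/\ forall n i, 0 <= a n i /\ a n i <= b n i /\ b n i <= t,
        forall n i, (exists M : R, forall w, `|xi n i w| <= M) /\
          forall U, open U -> F (a n i) (xi n i @^-1` U),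
        {ae P, forall w, forall n, measurable_fun `[0, t] (err n w)},
        cvg0_in_probability (fun n w =>
          \int[lebesgue_measure]_(u in `[0%R, t]) (err n w u ^+ 2)%:E)%E &
        cvg0_in_probability (fun n w =>
          (`|\sum_(i < N n) (W (b n i) w - W (a n i) w) *: xi n i w
             - Y w|)%:E)].

Definition vanishing_partitions (t : R) (N : nat -> nat) (p : nat -> nat -> R)
    : Prop :=
  [/\ forall n, p n 0%N = 0 /\ p n (N n) = t,
      forall n i, (i < N n)%N -> p n i <= p n i.+1 &
      forall e : R, 0 < e -> \forall n \near \oo, forall i, (i < N n)%N ->
        p n i.+1 - p n i < e].

(* The (Fisk-)Stratonovich integral: limit in probability of the trapezoidal
   sums, along every sequence of partitions whose mesh tends to 0. *)
Definition stratonovich_integral (W : R -> Omega -> R) (t : R)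
    (Phi : R -> Omega -> X) (Y : Omega -> X) : Prop :=
  forall N p, vanishing_partitions t N p ->
    cvg0_in_probability (fun n w =>
      (`|\sum_(i < N n) (W (p n i.+1) w - W (p n i) w) *:
           (2^-1 *: (Phi (p n i) w + Phi (p n i.+1) w)) - Y w|)%:E).

(* x(t, x0) is the mild solution of
   dx = (A x + alpha x) dt + sum_j sigma_j x dW^j, where S t = e^(tA). *)
Definition mild_solution (d : nat) (W : 'I_d -> R -> Omega -> R)
    (S : R -> X -> X) (alpha : X -> X) (sigma : 'I_d -> X -> X)
    (x : R -> X -> Omega -> X) : Prop :=
  forall x0, [/\ adapted (x ^~ x0), continuous_paths (x ^~ x0) &
    forall t, 0 <= t -> exists2 Y : 'I_d -> Omega -> X,
      forall j, ito_integral (W j) t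
        (fun u w => S (t - u) (sigma j (x u x0 w))) (Y j) &
      {ae P, forall w, exists2 v : X,
        bochner_integral t (fun u => S (t - u) (alpha (x u x0 w))) v &
        x t x0 w = S t x0 + v + \sum_(j < d) Y j w}].

(* dz = sigma z o dW, z(0) = x0. *)
Definition stratonovich_solution (W : R -> Omega -> R) (sigma : X -> X)
    (z : R -> X -> Omega -> X) : Prop :=
  forall x0, [/\ adapted (z ^~ x0), continuous_paths (z ^~ x0) &
    forall t, 0 <= t -> exists2 Y : Omega -> X,
      stratonovich_integral W t (fun u w => sigma (z u x0 w)) Y &
      {ae P, forall w, z t x0 w = x0 + Y w}].

(* P_t f (x0) = E[f(x(t, x0))] for x0 in dom A^l. The extension of f by 0
   off dom A^l is immaterial, as x(t, x0) lies in dom A^l almost surely. *)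
Definition transition (A : X -> X) (domA : set X) (l : nat)
    (x : R -> X -> Omega -> X) (t : R) (f : set_type (domn A domA l) -> R)
    (x0 : set_type (domn A domA l)) : R :=
  fine 'E_P[fun w => extend0 f (x t (val x0) w)].

End Stochastic.

(* dz/dt = A z + alpha0 z, z(0) = x0, in the mild sense, since x0 need not
   belong to dom A. *)
Definition mild_ode_solution (R : realType) (X : completeNormedModType R)
    (S : R -> X -> X) (alpha0 : X -> X) (z : R -> X -> X) : Prop :=
  forall x0, {within `[0, +oo[, continuous (z ^~ x0)} /\
    forall t, 0 <= t -> exists2 v : X,
      bochner_integral t (fun u => S (t - u) (alpha0 (z u x0))) v &
      z t x0 = S t x0 + v.

(* Index 0 is the deterministic flow z^0, index j.+1 the j-th component of
   the noise. *)
Definition split_flow (R : realType) (X Omega : Type) (d : nat)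
    (z0 : R -> X -> X) (z : 'I_d -> R -> X -> Omega -> X) (j : 'I_d.+1) :
    R -> X -> Omega -> X :=
  if unlift ord0 j is Some k then z k else fun t x0 _ => z0 t x0.

Section Splitting.
Variables (R : realType) (V : lmodType R) (nrm : V -> \bar R) (E : set V).
Variables (d : nat) (Pt : R -> V -> V) (Pj : 'I_d.+1 -> R -> V -> V).

(* P^0_dt P^1_dt ... P^d_dt f *)
Definition euler_splitting (dt : R) (f : V) : V :=
  foldr (fun j g => Pj j dt g) f (enum 'I_d.+1).

Definition gen_split (j : 'I_d.+1) : V -> V -> Prop :=
  generator nrm E (Pj j).

Definition MT (q : nat) (T : R) : set V := [set f |
  [/\ E f,
      forall t, 0 <= t <= T ->
        (exists g, oppow (generator nrm E Pt) q (Pt t f) g) /\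
        (forall j, exists g, oppow (gen_split j) q (Pt t f) g),
      exists K : R, forall t (js : q.-tuple 'I_d.+1), 0 <= t <= T ->
        exists2 g, opcomp (map gen_split js) (Pt t f) g & (nrm g <= K%:E)%E &
      forall t i, 0 <= t <= T -> (1 <= i <= q)%N ->
        exists2 g, oppow (generator nrm E Pt) i (Pt t f) g &
          oppow (opsum gen_split) i (Pt t f) g]].

Definition MTEuler (T : R) : set V := MT 2 T.

End Splitting.

(* Main.v *)
Require Import Defs.
From HB Require Import structures.
From mathcomp Require Import all_boot all_order all_algebra.
From mathcomp Require Import all_classical all_reals all_analysis.
From mathcomp Require Import ring lra.

Set Implicit Arguments.
Unset Strict Implicit.
Unset Printing Implicit Defensive.

Import Order.TTheory GRing.Theory Num.Theory.
Import numFieldNormedType.Exports.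

Local Open Scope classical_set_scope.
Local Open Scope ring_scope.

(** The estimate is one of semigroup theory, for [Pt] and the [Pj] acting on the
    weighted space: local consistency of second order, plus stability.

    A semigroup bounded by [M] on [[0, T]] satisfies the Taylor estimates
    [|S t x - x| <= t M |G x|] and [|S t x - x - t G x| <= M |G (G x)| t^2].
    They are proved without integrating: [[0, t]] is cut into [n] equal pieces
    of length [h], and in the telescoping identity
    [S (n h) x - x - n h y =
       \sum_(k < n) (S (k h) (S h x - x - h y) + h (S (k h) y - y))]
    the definition of the generator controls [S h x - x - h y] as [n] grows
    ([subdivision_bound], [subdivision_limit]).

    Let [x = Pt t f]. Expanding [Pt dt x] to second order gives
    [x + dt G x + O(dt^2)]. Expanding the product of the [Pj dt] from the
    right, one factor at a time ([ordered_product_expansion]), gives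
    [x + dt \sum_j G_j x + O(dt^2)], with a constant governed by a bound
    on the norms of the [G_i (G_j x)]. On the regularity class, those norms are bounded
    uniformly in [t], the two first-order terms agree, and
    [G (G x) = \sum_i \sum_j G_i (G_j x)] ([MT2_derivatives]). So one step
    commits an error [L dt^2]. By the growth bounds the [n]-step error [e n]
    obeys [e n.+1 <= L dt^2 + exp (w dt) * e n], hence is at most
    [n dt L exp (w n dt) dt], which is [O(dt)] when [n dt <= T]
    ([euler_splitting_error]). What remains is that the weighted space is a
    normed space ([Bpsi_normed_subspace]). *)

(** * Subspaces with an extended-real norm *)

Record normed_subspace (R : realType) (V : lmodType R) (nrm : V -> \bar R)
    (E : set V) : Prop := NormedSubspace {
  normed_subspace_lin :
    forall (a : R) x y, E x -> E y -> E (a *: x + y);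
  normed_subspace0 : E 0;
  nrm_fin : forall x, E x -> nrm x \is a fin_num;
  nrm_triangle : forall x y, E x -> E y -> (nrm (x + y)%R <= nrm x + nrm y)%E;
  nrm_scale : forall (a : R) x, E x -> nrm (a *: x) = (`|a|%:E * nrm x)%E;
  nrm_eq0 : forall x, E x -> nrm x = 0%E -> x = 0 }.

Section NormedSubspace.
Variables (R : realType) (V : lmodType R) (nrm : V -> \bar R) (E : set V).
Hypothesis nE : normed_subspace nrm E.
Implicit Types (x y z : V) (S : R -> V -> V).

Notation N x := (fine (nrm x)).

Lemma subspaceD x y : E x -> E y -> E (x + y).
Proof.
by move=> Ex Ey; rewrite -[x]scale1r; apply: (normed_subspace_lin nE).
Qed.

Lemma subspaceZ (a : R) x : E x -> E (a *: x).
Proof.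
move=> Ex; rewrite -[_ *: _]addr0; apply: (normed_subspace_lin nE) => //.
exact: normed_subspace0 nE.
Qed.

Lemma subspaceB x y : E x -> E y -> E (x - y).
Proof. by move=> Ex Ey; rewrite -scaleN1r; apply/subspaceD/subspaceZ. Qed.

Lemma subspace_sum (I : Type) (r : seq I) (F : I -> V) :
  (forall i, E (F i)) -> E (\sum_(i <- r) F i).
Proof.
move=> EF; elim/big_ind: _ => //; first exact: normed_subspace0 nE.
by move=> x y; exact: subspaceD.
Qed.

Lemma nrmE x : E x -> nrm x = (N x)%:E.
Proof. by move=> /(nrm_fin nE) /fineK. Qed.

Lemma ler_nrmD x y : E x -> E y -> N (x + y) <= N x + N y.
Proof.
move=> Ex Ey; have := nrm_triangle nE Ex Ey.
by rewrite (nrmE Ex) (nrmE Ey) (nrmE (subspaceD Ex Ey)).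
Qed.

Lemma nrmZ (a : R) x : E x -> N (a *: x) = `|a| * N x.
Proof. by move=> Ex; rewrite (nrm_scale nE) // fineM // (nrm_fin nE). Qed.

Lemma nrm_zero : N 0 = 0.
Proof.
have E0 := normed_subspace0 nE.
by rewrite -(scale0r 0) nrmZ // normr0 mul0r.
Qed.

Lemma nrm_ge0 x : E x -> 0 <= N x.
Proof.
move=> Ex; have := ler_nrmD Ex (subspaceZ (-1) Ex).
by rewrite nrmZ // normrN1 mul1r scaleN1r subrr nrm_zero; lra.
Qed.

Lemma nrm_zero_eq x : E x -> N x <= 0 -> x = 0.
Proof.
move=> Ex Nx; apply: (nrm_eq0 nE) => //; rewrite (nrmE Ex); congr (_%:E).
by apply/eqP; rewrite eq_le Nx nrm_ge0.
Qed.

Lemma ler_nrmB x y : E x -> E y -> N (x - y) <= N x + N y.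
Proof.
move=> Ex Ey; rewrite -scaleN1r (le_trans (ler_nrmD Ex (subspaceZ _ Ey))) //.
by rewrite nrmZ // normrN1 mul1r.
Qed.

Lemma ler_nrm_sum (I : Type) (r : seq I) (F : I -> V) (K : R) :
  (forall i, E (F i)) -> (forall i, N (F i) <= K) ->
  N (\sum_(i <- r) F i) <= (size r)%:R * K.
Proof.
move=> EF FK; elim: r => [|i r IH]; first by rewrite big_nil nrm_zero mul0r.
rewrite big_cons /= (le_trans (ler_nrmD _ (subspace_sum _ EF))) //.
by rewrite -natr1 mulrDl mul1r addrC lerD.
Qed.

(** The limit that defines the generator, with the quotient by [h] cleared:
    this form can be added, and compared with the terms of a subdivision. *)
Lemma generatorP S x y : (forall h z, 0 <= h -> E z -> E (S h z)) ->
  generator nrm E S x y <->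
  [/\ E x, E y & forall e, 0 < e -> exists2 del : R, 0 < del &
     forall h, 0 < h < del -> N (S h x - x - h *: y) <= h * e].
Proof.
move=> ES.
have qE h : 0 < h -> E x -> E y -> E (h^-1 *: (S h x - x) - y).
  by move=> h0 Ex Ey; apply/subspaceB/Ey/subspaceZ/subspaceB/Ex/ES/Ex/ltW.
have qN h : 0 < h -> E x -> E y ->
    N (S h x - x - h *: y) = h * N (h^-1 *: (S h x - x) - y).
  move=> h0 Ex Ey; rewrite -[X in _ = X * _](gtr0_norm h0).
  rewrite -nrmZ; last exact: qE.
  by rewrite scalerBr scalerA divff ?gt_eqF// scale1r.
split=> -[Ex Ey].
- move=> /fine_cvgP[_ /cvgr0Pnorm_lt lim]; split=> // e /lim /=.
  rewrite /at_right near_withinE => -[del /= del0 H]; exists del => // h.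
  move=> /andP[h0 hd]; rewrite qN // ler_pM2l // ltW //.
  apply: le_lt_trans (H h _ h0); first exact: ler_norm.
  by rewrite /ball_ /= sub0r normrN gtr0_norm.
- move=> H; split=> //; apply/fine_cvgP; split.
    near=> h; apply: (nrm_fin nE); apply: qE => //.
  apply/cvgr0Pnorm_le => e /H[del del0 He]; near=> h.
  have h0 : 0 < h by near: h; exact: nbhs_right_gt.
  rewrite /= ger0_norm; last exact/nrm_ge0/qE.
  rewrite -(ler_pM2l h0) -qN //; apply: He; rewrite h0 /=.
  by near: h; exact: nbhs_right_lt.
Unshelve. all: by end_near. Qed.

End NormedSubspace.

(** * Taylor estimates for strongly continuous semigroups *)

Section C0Semigroup.
Variables (R : realType) (V : lmodType R) (nrm : V -> \bar R) (E : set V).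
Hypothesis nE : normed_subspace nrm E.
Variable S : R -> V -> V.
Hypothesis S_c0 : c0_semigroup nrm E S.
Implicit Types (x y z : V).

Notation N x := (fine (nrm x)).
Notation gen := (generator nrm E S).

Lemma semigroup_stable h x : 0 <= h -> E x -> E (S h x).
Proof. by case: S_c0 => + _; apply. Qed.

Lemma semigroup_scaleD (a h : R) x y :
  0 <= h -> E x -> E y -> S h (a *: x + y) = a *: S h x + S h y.
Proof. by case: S_c0 => _ [+ _]; apply. Qed.

Lemma semigroupD h x y : 0 <= h -> E x -> E y -> S h (x + y) = S h x + S h y.
Proof.
by move=> h0 Ex Ey; rewrite -[x in LHS]scale1r semigroup_scaleD // scale1r.
Qed.

Lemma semigroup_zero h : 0 <= h -> S h 0 = 0.
Proof.
move=> h0; have E0 := normed_subspace0 nE; apply: (addrI (S h 0)).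
by rewrite -semigroupD // !addr0.
Qed.

Lemma semigroup_at0 x : E x -> S 0 x = x.
Proof. by case: S_c0 => _ [_ [_ [+ _]]]; apply. Qed.

Lemma semigroup_add s t x :
  0 <= s -> 0 <= t -> E x -> S (s + t) x = S s (S t x).
Proof. by case: S_c0 => _ [_ [_ [_ [+ _]]]]; apply. Qed.

Let genP x y := @generatorP R V nrm E nE S x y semigroup_stable.

Lemma generator0 : gen 0 0.
Proof.
have E0 := normed_subspace0 nE; apply/genP; split=> // e e0; exists 1 => // h.
move=> /andP[h0 _].
rewrite (semigroup_zero (ltW h0)) scaler0 !subr0 (nrm_zero nE).
by rewrite mulr_ge0 ?(ltW h0) ?(ltW e0).
Qed.

Lemma generatorD x y x' y' : gen x y -> gen x' y' -> gen (x + x') (y + y').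
Proof.
move=> /genP[Ex Ey xy] /genP[Ex' Ey' xy']; apply/genP.
split; [exact: (subspaceD nE)|exact: (subspaceD nE)|move=> e e0].
have e20 : 0 < e / 2 by lra.
have [d1 d10 H1] := xy _ e20; have [d2 d20 H2] := xy' _ e20.
exists (Order.min d1 d2); first by rewrite lt_min d10.
move=> h /andP[h0]; rewrite lt_min => /andP[hd1 hd2].
have ES z : E z -> E (S h z) by apply: semigroup_stable; exact: ltW.
have -> : S h (x + x') - (x + x') - h *: (y + y') =
    (S h x - x - h *: y) + (S h x' - x' - h *: y').
  rewrite (semigroupD (ltW h0)) // scalerDr !opprD !addrA.
  by rewrite [LHS](ACl (1*3*5*2*4*6)).
have -> : h * e = h * (e / 2) + h * (e / 2) by lra.
rewrite (le_trans (ler_nrmD nE _ _)) ?lerD ?H1 ?H2 ?h0 ?hd1 ?hd2 //.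
all: apply/(subspaceB nE)/(subspaceZ nE) => //.
all: by apply: (subspaceB nE) => //; exact: ES.
Qed.

Lemma generator_sum (I : Type) (r : seq I) (F G : I -> V) :
  (forall i, gen (F i) (G i)) ->
  gen (\sum_(i <- r) F i) (\sum_(i <- r) G i).
Proof.
move=> FG; elim/big_ind2: _ => //; first exact: generator0.
by move=> x y x' y'; exact: generatorD.
Qed.

Lemma generator_unique x y y' : gen x y -> gen x y' -> y = y'.
Proof.
move=> /genP[Ex Ey xy] /genP[_ Ey' xy'].
apply/eqP; rewrite -subr_eq0; apply/eqP.
apply: (nrm_zero_eq nE); first exact: (subspaceB nE).
apply/ler_addgt0Pl => e e0; rewrite addr0.
have e20 : 0 < e / 2 by lra.
have [d1 d10 H1] := xy _ e20; have [d2 d20 H2] := xy' _ e20.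
pose h := Order.min d1 d2 / 2.
have h0 : 0 < h by rewrite divr_gt0 // lt_min d10.
have [hd1 hd2] : h < d1 /\ h < d2.
  by apply/andP; rewrite -lt_min /h; move: h0; rewrite /h; lra.
have ES z : E z -> E (S h z) by apply: semigroup_stable; exact: ltW.
have ET z : E z -> E (S h x - x - h *: z).
  by move=> Ez; apply/(subspaceB nE)/(subspaceZ nE) => //;
     apply: (subspaceB nE) => //; exact: ES.
rewrite -(ler_pM2l h0) -[X in X * _ <= _](gtr0_norm h0).
rewrite -(nrmZ nE); last exact: (subspaceB nE).
have -> : h *: (y - y') = (S h x - x - h *: y') - (S h x - x - h *: y).
  by rewrite scalerBr [in RHS]opprB [RHS]addrC subrKA.
have -> : h * e = h * (e / 2) + h * (e / 2) by lra.
by rewrite (le_trans (ler_nrmB nE (ET _ Ey') (ET _ Ey))) ?lerD ?H1 ?H2 ?h0 ?hd1.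
Qed.

Variables (T M : R).
Hypothesis M_ge0 : 0 <= M.
Hypothesis S_bounded :
  forall t x, 0 <= t <= T -> E x -> N (S t x) <= M * N x.

(** Induction on [n] by the identity
    [S (n h + h) x - x - (n h + h) y =
       S (n h) (S h x - x - h y) + h (S (n h) y - y) + (S (n h) x - x - n h y)],
    where [y] is arbitrary; [y = 0] serves for first-order estimates and
    [y = G x] for second-order ones. *)
Lemma subdivision_bound x y (B h : R) (n : nat) :
  E x -> E y -> 0 <= h -> n%:R * h <= T ->
  (forall s, 0 <= s <= n%:R * h -> N (S s y - y) <= B) ->
  N (S (n%:R * h) x - x - (n%:R * h) *: y) <=
    n%:R * (M * N (S h x - x - h *: y) + h * B).
Proof.
move=> Ex Ey h0; elim: n => [|n IH] nT yB.
  by rewrite !mul0r semigroup_at0 // scale0r subr0 subrr (nrm_zero nE).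
have nS : n.+1%:R * h = n%:R * h + h by rewrite -natr1 mulrDl mul1r.
rewrite nS in nT yB *; set t := n%:R * h in IH nT yB *.
have t0 : 0 <= t by rewrite mulr_ge0.
have EB u v : E u -> E v -> E (u - v) by exact: (subspaceB nE).
have ES s z : 0 <= s -> E z -> E (S s z) by exact: semigroup_stable.
have EZ (a : R) z : E z -> E (a *: z) by exact: (subspaceZ nE).
set p := S h x - x - h *: y.
have Ep : E p by apply/EB/EZ/Ey/EB/Ex/ES.
have -> : S (t + h) x - x - (t + h) *: y =
    S t p + h *: (S t y - y) + (S t x - x - t *: y).
  rewrite semigroup_add // (_ : S h x = p + (h *: y + x)); last first.
    by rewrite /p [h *: y + x]addrC addrA addrAC subrK subrK.
  rewrite semigroupD //; last exact: (normed_subspace_lin nE).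
  rewrite semigroup_scaleD // scalerBr scalerDl opprD !addrA.
  by rewrite [LHS](ACl (1*2*6*3*4*5)).
have -> : n.+1%:R * (M * N p + h * B) =
    M * N p + h * B + n%:R * (M * N p + h * B) by rewrite -natr1; ring.
have Eq : E (S t y - y) by apply/EB/Ey/ES.
have E1 : E (S t p + h *: (S t y - y)) by apply/(subspaceD nE)/EZ/Eq/ES.
have E2 : E (S t x - x - t *: y) by apply/EB/EZ/Ey/EB/Ex/ES.
rewrite (le_trans (ler_nrmD nE E1 E2)) //.
rewrite lerD //; last first.
  by apply: IH => [|s /andP[s0 st]]; [lra|apply: yB; rewrite s0; lra].
rewrite (le_trans (ler_nrmD nE (ES _ _ t0 Ep) (EZ h _ Eq))) // lerD //.
  by apply: S_bounded => //; rewrite t0; lra.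
by rewrite (nrmZ nE) // ger0_norm // ler_wpM2l // yB // t0; lra.
Qed.

(** A bound on the increments over short times propagates to time [t]: in
    [subdivision_bound] with [h = t / n], the factor [n h] equals [t] whatever
    the fineness of the subdivision. *)
Lemma subdivision_limit x y (b B t : R) : E x -> E y -> 0 <= t <= T ->
  (forall e, 0 < e -> exists2 del : R, 0 < del &
    forall h, 0 < h < del -> N (S h x - x - h *: y) <= h * (b + e)) ->
  (forall s, 0 <= s <= t -> N (S s y - y) <= B) ->
  N (S t x - x - t *: y) <= t * (M * b + B).
Proof.
move=> Ex Ey /andP[t0 tT] xy yB.
have [t00|tn0] := eqVneq t 0.
  by rewrite t00 semigroup_at0 // scale0r subr0 subrr (nrm_zero nE) mul0r.
have {tn0}t0 : 0 < t by rewrite lt_neqAle eq_sym tn0.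
apply/ler_addgt0Pl => e e0.
have M1 : 0 < M + 1 by move: M_ge0; lra.
(* M + 1 instead of M, which may vanish. *)
have e'0 : 0 < e / (t * (M + 1)) by rewrite divr_gt0 ?mulr_gt0.
have [del del0 H] := xy _ e'0.
have [n n0 nd] : exists2 n : nat, (0 < n)%N & t / n%:R < del.
  exists (Num.truncn (t / del)).+1 => //.
  by rewrite ltr_pdivrMr // mulrC -ltr_pdivrMr // truncnS_gt.
have nt : n%:R * (t / n%:R) = t.
  by rewrite mulrCA divff ?mulr1 ?pnatr_eq0 -?lt0n.
have h0 : 0 < t / n%:R by rewrite divr_gt0 // ltr0n.
have := @subdivision_bound x y B (t / n%:R) n Ex Ey (ltW h0); rewrite nt.
move=> /(_ tT yB) /le_trans; apply.
have := H _ (introT andP (conj h0 nd)); set p := N _ => pe.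
apply: (@le_trans _ _
  (n%:R * (M * (t / n%:R * (b + e / (t * (M + 1)))) + t / n%:R * B))).
  by rewrite ler_wpM2l // lerD2r ler_wpM2l.
have -> : n%:R * (M * (t / n%:R * (b + e / (t * (M + 1)))) + t / n%:R * B) =
    e * (M / (M + 1)) + t * (M * b + B).
  by field; rewrite !gt_eqF ?ltr0n.
by rewrite lerD2r ger_pMr // ler_pdivrMr //; move: M_ge0; lra.
Qed.

Lemma taylor1 x y t : gen x y -> 0 <= t <= T -> N (S t x - x) <= t * (M * N y).
Proof.
move=> /genP[Ex Ey xy] /[dup] tT /andP[t0 _].
have E0 := normed_subspace0 nE.
have := @subdivision_limit x 0 (N y) 0 t Ex E0 tT.
rewrite scaler0 subr0 addr0; apply=> [e e0|s /andP[s0 _]]; last first.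
  by rewrite semigroup_zero // subrr (nrm_zero nE).
have [del del0 H] := xy e e0; exists del => // h hd.
rewrite scaler0 subr0 mulrDr; have /andP[h0 _] := hd.
have ES : E (S h x - x) by apply/(subspaceB nE)/Ex/semigroup_stable/Ex/ltW.
have Ehy : E (h *: y) by exact: (subspaceZ nE).
rewrite -[S h x - x](subrK (h *: y)).
rewrite (le_trans (ler_nrmD nE (subspaceB nE ES Ehy) Ehy)) // addrC.
by rewrite (nrmZ nE) // gtr0_norm // lerD2l H.
Qed.

Lemma taylor2 x y z t : gen x y -> gen y z -> 0 <= t <= T ->
  N (S t x - x - t *: y) <= M * N z * t ^+ 2.
Proof.
move=> /genP[Ex Ey xy] yz /[dup] tT /andP[t0 tT'].
have Nz : 0 <= N z by apply: (nrm_ge0 nE); case: yz.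
have -> : M * N z * t ^+ 2 = t * (M * 0 + t * (M * N z)) by ring.
apply: subdivision_limit => // [e e0|s /andP[s0 st]].
  by have [del del0 H] := xy e e0; exists del => // h /H; rewrite add0r.
apply: (le_trans (taylor1 yz _)); first by rewrite s0; lra.
by rewrite ler_wpM2r ?mulr_ge0.
Qed.

End C0Semigroup.

(** * Local and global error of the Euler splitting *)

Section Splitting.
Variables (R : realType) (V : lmodType R) (nrm : V -> \bar R) (E : set V).
Hypothesis nE : normed_subspace nrm E.
Notation N x := (fine (nrm x)).

Definition ordered_product (I : Type) (S : I -> R -> V -> V) (l : seq I) (t : R)
  (x : V) : V := foldr (fun i y => S i t y) x l.

Section Product.
Variables (I : Type) (S : I -> R -> V -> V).
Hypothesis S_c0 : forall i, c0_semigroup nrm E (S i).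

Lemma ordered_product_stable l t x :
  0 <= t -> E x -> E (ordered_product S l t x).
Proof.
by move=> t0 Ex; elim: l => //= i l IH; exact: (semigroup_stable (S_c0 i)).
Qed.

Lemma ordered_productB l t x y : 0 <= t -> E x -> E y ->
  ordered_product S l t (x - y) =
  ordered_product S l t x - ordered_product S l t y.
Proof.
move=> t0 Ex Ey; elim: l => //= i l ->.
have EP z : E z -> E (ordered_product S l t z) by exact: ordered_product_stable.
rewrite -scaleN1r addrC (semigroup_scaleD (S_c0 i)) //; try exact: EP.
by rewrite scaleN1r addrC.
Qed.

Lemma ordered_product_growth (w : I -> R) (l : seq I) t x :
  (forall i, growth_bound nrm E (S i) (w i)) -> 0 <= t -> E x ->
  N (ordered_product S l t x) <= expR ((\sum_(i <- l) w i) * t) * N x.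
Proof.
move=> Sw t0 Ex; elim: l => [|i l IH] /=.
  by rewrite big_nil mul0r expR0 mul1r.
have EP : E (ordered_product S l t x) by exact: ordered_product_stable.
have := Sw i t _ t0 EP.
rewrite (nrmE nE EP) (nrmE nE (semigroup_stable (S_c0 i) t0 EP)) lee_fin.
move=> /le_trans; apply.
by rewrite big_cons mulrDl expRD -mulrA ler_wpM2l // expR_ge0.
Qed.

Variables (T M : R).
Hypothesis M_ge0 : 0 <= M.
Hypothesis S_bounded :
  forall i t x, 0 <= t <= T -> E x -> N (S i t x) <= M * N x.

(** Induction on the number of factors. If the product over [l] maps [x] to
    [x + t s + r] with [s] the sum of the first derivatives, applying [S i t]
    creates the errors [S i t x - x - t (a i)], of second order;
    [t (S i t s - s)], a first-order increment multiplied by [t]; and [S i t r],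
    where [S i t] is bounded. *)
Lemma ordered_product_expansion (K : R) (l : seq I) :
  exists C : R, forall (t : R) (x : V) (a : I -> V) (b : I -> I -> V),
    0 <= t <= T -> (forall i, generator nrm E (S i) x (a i)) ->
    (forall i j, generator nrm E (S i) (a j) (b i j)) ->
    (forall i j, N (b i j) <= K) ->
    N (ordered_product S l t x - x - t *: \sum_(j <- l) a j) <= C * t ^+ 2.
Proof.
elim: l => [|i l [C IH]].
  exists 0 => t x a b _ _ _ _.
  by rewrite /= big_nil scaler0 subr0 subrr (nrm_zero nE) mul0r.
exists (M * K + (M * ((size l)%:R * K) + M * C)).
move=> t x a b /[dup] tT /andP[t0 _] xa ab bK.
have Ex : E x by case: (xa i).
have Ea j : E (a j) by case: (xa j).
have Eb j : E (b i j) by case: (ab i j).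
have EB u v : E u -> E v -> E (u - v) by exact: (subspaceB nE).
have EZ (c : R) z : E z -> E (c *: z) by exact: (subspaceZ nE).
have ES z : E z -> E (S i t z) by exact: (semigroup_stable (S_c0 i)).
have Ey : E (ordered_product S l t x) by exact: ordered_product_stable.
set y := ordered_product S l t x in Ey *.
rewrite [ordered_product _ _ _ _]/= -/(ordered_product S l t x) -/y big_cons.
set s := \sum_(j <- l) a j.
have Es : E s by exact: (subspace_sum nE).
set r := y - x - t *: s.
have Er : E r by apply/EB/EZ/Es/EB/Ex.
have -> : S i t y - x - t *: (a i + s) =
    (S i t x - x - t *: a i) + (t *: (S i t s - s) + S i t r).
  rewrite (_ : y = t *: s + (x + r)); last first.
    by rewrite addrA [RHS]addrC /r addrA !subrK.
  rewrite (semigroup_scaleD (S_c0 i)) //; last exact: (subspaceD nE).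
  rewrite (semigroupD (S_c0 i)) // scalerDr scalerBr !opprD !addrA.
  by rewrite [LHS](ACl (2*4*5*1*6*3)).
have E1 : E (S i t x - x - t *: a i) by apply/EB/EZ/Ea/EB/Ex/ES.
have E2 : E (t *: (S i t s - s)) by apply/EZ/EB/Es/ES.
rewrite mulrDl (le_trans (ler_nrmD nE E1 (subspaceD nE E2 (ES _ Er)))) //.
rewrite lerD //.
  have := taylor2 nE (S_c0 i) M_ge0 (@S_bounded i) (xa i) (ab i i) tT.
  move=> /le_trans; apply.
  by rewrite ler_wpM2r ?sqr_ge0 // ler_wpM2l.
rewrite mulrDl (le_trans (ler_nrmD nE E2 (ES _ Er))) // lerD //.
  have gs := generator_sum nE (S_c0 i) l (ab i).
  rewrite (nrmZ nE) ?ger0_norm //; last exact/EB/Es/ES.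
  have := taylor1 nE (S_c0 i) M_ge0 (@S_bounded i) gs tT.
  move=> /(ler_wpM2l t0) /le_trans; apply.
  rewrite (_ : t * (t * (M * N (\sum_(j <- l) b i j))) =
    M * N (\sum_(j <- l) b i j) * t ^+ 2); last by ring.
  rewrite ler_wpM2r ?sqr_ge0 // ler_wpM2l //.
  exact: (ler_nrm_sum nE).
rewrite (le_trans (S_bounded i tT Er)) // -mulrA ler_wpM2l //.
exact: (IH _ _ _ b).
Qed.

End Product.

Variables (d : nat) (Pt : R -> V -> V) (Pj : 'I_d.+1 -> R -> V -> V).
Hypothesis Pt_c0 : c0_semigroup nrm E Pt.
Hypothesis Pj_c0 : forall j, c0_semigroup nrm E (Pj j).

Lemma growth_bound_bounded (S : R -> V -> V) (w w' T t : R) x :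
  c0_semigroup nrm E S ->
  growth_bound nrm E S w -> `|w| <= w' -> 0 <= t <= T -> E x ->
  N (S t x) <= expR (w' * T) * N x.
Proof.
move=> S_c0 Sw ww' /andP[t0 tT] Ex; have := Sw t x t0 Ex.
rewrite (nrmE nE Ex) (nrmE nE (semigroup_stable S_c0 t0 Ex)) lee_fin.
move=> /le_trans; apply; rewrite ler_wpM2r ?(nrm_ge0 nE) // ler_expR.
rewrite (le_trans (ler_norm _)) // normrM (ger0_norm t0).
by rewrite ler_pM ?normr_ge0.
Qed.

(** The clauses of the regularity class provide separate values for the iterated
    generators. Uniqueness of the generator identifies them with one family
    of derivatives [a], [b], and linearity expresses the square of the sum of
    the generators through the [b i j], the only terms with a norm bound. *)
Lemma MT2_derivatives (T : R) f : 0 <= T -> MT nrm E Pt Pj 2 T f ->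
  exists K : R, forall t, 0 <= t <= T ->
    exists (a : 'I_d.+1 -> V) (b : 'I_d.+1 -> 'I_d.+1 -> V),
    [/\ forall j, generator nrm E (Pj j) (Pt t f) (a j),
        forall i j, generator nrm E (Pj i) (a j) (b i j),
        forall i j, N (b i j) <= K,
        generator nrm E Pt (Pt t f) (\sum_j a j) &
        generator nrm E Pt (\sum_j a j) (\sum_i \sum_j b i j)].
Proof.
move=> T0 [_ _ [K HK] Hpow]; exists K => t tT.
have gP := generator_unique nE Pt_c0.
have gPj j := generator_unique nE (Pj_c0 j).
have [g1 [_ -> Gg1] [_ -> [a xa g1E]]] := Hpow t 1%N tT isT.
have [g2 [z1 [_ -> Pz1] Gg2] [z2 [_ -> [a' xa' z2E]] [h zh g2E]]] :=
  Hpow t 2%N tT isT.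
have aE j : a' j = a j by exact: (gPj j) (xa' j) (xa j).
have {z2E}z2E : z2 = \sum_j a j by rewrite z2E; exact: eq_bigr.
have z1E : z1 = \sum_j a j by rewrite -g1E; exact: gP Pz1 Gg1.
subst z1 z2; rewrite g1E in Gg1.
have /choice[b bP] : forall ij : 'I_d.+1 * 'I_d.+1, exists b : V,
    generator nrm E (Pj ij.1) (a ij.2) b /\ (nrm b <= K%:E)%E.
  move=> [i j]; have [b [z [_ -> xz] zb] bK] := HK t [tuple i; j] tT.
  by exists b; split=> //; rewrite -(gPj j _ _ _ xz (xa j)).
exists a, (fun i j => b (i, j)); split=> // [i j|i j|].
- by case: (bP (i, j)).
- have [[_ Eb _] ] := bP (i, j).
  by rewrite (nrmE nE Eb) lee_fin.
- rewrite g2E in Gg2; suff <- : \sum_i h i = \sum_i \sum_j b (i, j) by [].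
  apply: eq_bigr => i _; apply: (gPj i) (zh i) _.
  by apply: (generator_sum nE (Pj_c0 i)) => j; case: (bP (i, j)).
Qed.

(** Consistency and stability give convergence: the [m]-step error splits as
    [(Pt dt - Q) (Pt s f) + Q (Pt s f - Q^m f)], where [Q] is one Euler step
    and [s = m dt]. The local error is evaluated along the exact solution
    [Pt s f], where the regularity class bounds the second derivatives; on the
    numerical solution there is no such bound. *)
Theorem euler_splitting_error (omega : R) (omegaj : 'I_d.+1 -> R) (T : R) f :
  growth_bound nrm E Pt omega ->
  (forall j, growth_bound nrm E (Pj j) (omegaj j)) ->
  0 < T -> MT nrm E Pt Pj 2 T f ->
  exists C : R, forall (n : nat) (dt : R), 0 < dt -> n%:R * dt <= T ->
    (nrm (Pt (n%:R * dt) f - iter n (euler_splitting Pj dt) f)%R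
       <= (C * dt)%:E)%E.
Proof.
move=> Pt_growth Pj_growth T0 fM.
have Ef : E f by case: fM.
have [K HK] := MT2_derivatives (ltW T0) fM.
(* A common growth rate: it dominates each of the semigroups, and also the
   sum of the rates, which is the growth rate of a whole Euler step. *)
pose w := `|omega| + \sum_j `|omegaj j|.
have sj0 : 0 <= \sum_j `|omegaj j| by apply: sumr_ge0.
have w_omegaj j : `|omegaj j| <= w.
  rewrite /w (bigD1 j) //= addrCA lerDl addr_ge0 //.
  by apply: sumr_ge0.
have w_omega : `|omega| <= w by rewrite lerDl.
have w0 : 0 <= w by apply: le_trans w_omega.
pose M := expR (w * T); have M0 : 0 <= M by exact: expR_ge0.
have Pt_bounded t x : 0 <= t <= T -> E x -> N (Pt t x) <= M * N x.
  exact: (growth_bound_bounded Pt_c0 Pt_growth w_omega).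
have Pj_bounded j t x : 0 <= t <= T -> E x -> N (Pj j t x) <= M * N x.
  exact: (growth_bound_bounded (Pj_c0 j) (Pj_growth j) (w_omegaj j)).
have [C HC] :=
  ordered_product_expansion Pj_c0 M0 Pj_bounded K (enum 'I_d.+1).
pose k : R := (d.+1)%:R; pose L := `|M * (k * (k * K)) + C|.
have EP t x : 0 <= t -> E x -> E (Pt t x) by exact: (semigroup_stable Pt_c0).
have EQ t x : 0 <= t -> E x -> E (euler_splitting Pj t x).
  exact: (ordered_product_stable Pj_c0).
have local dt t : 0 <= dt <= T -> 0 <= t <= T ->
    N (Pt dt (Pt t f) - euler_splitting Pj dt (Pt t f)) <= L * dt ^+ 2.
  move=> /[dup] dtT /andP[dt0 _] /[dup] tT /andP[t0 _].
  have [a [b [xa ab bK Ga Gb]]] := HK t tT.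
  (* Both one-step maps are compared with x + dt * \sum_j a j. *)
  have Ex : E (Pt t f) by exact: EP.
  have Ea : E (dt *: \sum_j a j).
    by apply: (subspaceZ nE); apply: (subspace_sum nE) => j; case: (xa j).
  have := taylor2 nE Pt_c0 M0 Pt_bounded Ga Gb dtT.
  have := HC dt _ a b dtT xa ab bK.
  rewrite big_enum -/(euler_splitting Pj dt (Pt t f)).
  set x := Pt t f in Ex *; set y := dt *: _ in Ea *.
  set p := Pt dt x; set q := euler_splitting Pj dt x => Nq Np.
  have Ep : E (p - x - y) by do 2 apply: (subspaceB nE) => //; exact: EP.
  have Eq : E (q - x - y) by do 2 apply: (subspaceB nE) => //; exact: EQ.
  have -> : p - q = (p - x - y) - (q - x - y).
    by rewrite opprB subrKA opprB subrKA.
  rewrite (le_trans (ler_nrmB nE Ep Eq)) //.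
  apply: le_trans (lerD Np Nq) _; rewrite -mulrDl ler_wpM2r ?sqr_ge0 //.
  rewrite (le_trans _ (ler_norm _)) // lerD2r ler_wpM2l //.
  have Ebi i : E (\sum_j b i j).
    by apply: (subspace_sum nE) => j; case: (ab i j).
  have Nbi i : N (\sum_j b i j) <= k * K.
    have Eb j : E (b i j) by case: (ab i j).
    have := ler_nrm_sum nE (enum 'I_d.+1) Eb (bK i).
    by rewrite size_enum_ord big_enum.
  have := ler_nrm_sum nE (enum 'I_d.+1) Ebi Nbi.
  by rewrite size_enum_ord big_enum.
have Q_growth dt x : 0 <= dt -> E x ->
    N (euler_splitting Pj dt x) <= expR (w * dt) * N x.
  move=> dt0 Ex.
  apply: le_trans (ordered_product_growth Pj_c0 _ Pj_growth dt0 Ex) _.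
  rewrite ler_wpM2r ?(nrm_ge0 nE) // ler_expR ler_wpM2r //.
  rewrite big_enum /=.
  apply: le_trans (ler_sum _ (fun j _ => ler_norm (omegaj j))) _.
  by rewrite lerDr.
exists (T * L * M) => n dt dt0 ndtT.
have dt_ge0 := ltW dt0.
have global m : m%:R * dt <= T -> E (iter m (euler_splitting Pj dt) f) /\
    N (Pt (m%:R * dt) f - iter m (euler_splitting Pj dt) f) <=
      m%:R * dt * L * expR (w * (m%:R * dt)) * dt.
  elim: m => [_|m IH mT].
    by rewrite /= !mul0r (semigroup_at0 Pt_c0 Ef) subrr (nrm_zero nE).
  have mS : m.+1%:R * dt = dt + m%:R * dt by rewrite -natr1 mulrDl mul1r addrC.
  rewrite mS in mT *; set s := m%:R * dt in IH mT *.
  have s0 : 0 <= s by rewrite mulr_ge0.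
  have [EI NI] : _ /\ _ := IH ltac:(lra).
  rewrite iterS; set y := iter m _ f in EI NI *.
  split; first exact: EQ.
  have Ex := EP s f s0 Ef.
  rewrite (semigroup_add Pt_c0) // -(subrKA (euler_splitting Pj dt (Pt s f))).
  rewrite -[in X in _ + X](ordered_productB Pj_c0 _ dt_ge0 Ex EI).
  have E1 : E (Pt dt (Pt s f) - euler_splitting Pj dt (Pt s f)).
    by apply: (subspaceB nE); [exact: EP|exact: EQ].
  have E2 : E (Pt s f - y) by exact: (subspaceB nE).
  apply: le_trans (ler_nrmD nE E1 (EQ _ _ dt_ge0 E2)) _.
  have l1 : N (Pt dt (Pt s f) - euler_splitting Pj dt (Pt s f)) <=
      L * dt ^+ 2 * expR (w * (dt + s)).
    apply: le_trans (local dt s _ _) _; [lra|lra|].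
    rewrite ler_peMr ?mulr_ge0 ?sqr_ge0 ?normr_ge0 //.
    by rewrite -expR0 ler_expR mulr_ge0 // addr_ge0.
  have l2 : N (euler_splitting Pj dt (Pt s f - y)) <=
      s * L * expR (w * (dt + s)) * dt.
    apply: le_trans (Q_growth _ _ dt_ge0 E2) _.
    apply: le_trans (ler_wpM2l (expR_ge0 _) NI) _.
    by rewrite mulrDr expRD le_eqVlt; apply/orP; left; apply/eqP; ring.
  apply: le_trans (lerD l1 l2) _.
  by rewrite le_eqVlt; apply/orP; left; apply/eqP; ring.
have [EI NI] := global n ndtT.
have EPn : E (Pt (n%:R * dt) f) by apply: EP; rewrite ?mulr_ge0.
rewrite (nrmE nE (subspaceB nE EPn EI)) lee_fin (le_trans NI) //.
have nd0 : 0 <= n%:R * dt by rewrite mulr_ge0.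
rewrite ler_wpM2r // ler_pM ?mulr_ge0 ?expR_ge0 ?normr_ge0 //.
  by rewrite ler_wpM2r ?normr_ge0.
by rewrite ler_expR ler_wpM2l.
Qed.

End Splitting.

(** * The weighted space as a normed space *)

Lemma enorm_normed_subspace (R : realType) (X : completeNormedModType R) :
  normed_subspace (@enorm R X) setT.
Proof.
split=> // [x y _ _|a x _|x _].
- by rewrite /enorm -EFinD lee_fin ler_normD.
- by rewrite /enorm normrZ EFinM.
- by move=> [/normr0_eq0].
Qed.

(** A supremum over the empty set would be -oo, so the weighted norm is a norm
    only because the domain is inhabited. *)
Lemma domn0 (R : realType) (X : completeNormedModType R) (A : X -> X)
    (domA : set X) (S : R -> X -> X) (l : nat) :
  c0_semigroup (@enorm R X) setT S -> generates A domA S -> domn A domA l 0.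
Proof.
move=> S_c0 S_gen.
have [dom0 A0] : domA 0 /\ A 0 = 0.
  exact/S_gen/(generator0 (enorm_normed_subspace X) S_c0).
by move=> k _; rewrite (_ : iter k A 0 = 0) //; elim: k => //= k ->.
Qed.

Section WeightedNorm.
Variables (R : realType) (X : completeNormedModType R).
Variables (A : X -> X) (domA : set X) (l : nat) (s : R).
Notation D := (set_type (domn A domA l)).
Notation psi := (@psi R X A domA l s).
Notation psi_norm := (@psi_norm R X A domA l s).
Notation Bpsi := (@Bpsi R X A domA l s).
Hypothesis D0 : domn A domA l 0.
Hypothesis s_ge0 : 0 <= s.
Implicit Types f g : D -> R.

Lemma psi_ge1 (x : D) : 1 <= psi x.
Proof.
rewrite /Defs.psi -[leLHS](@powRr0 R (1 + normn A l (val x) ^+ 2)).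
by rewrite ler_powR ?divr_ge0 // lerDl sqr_ge0.
Qed.

Let psi_gt0 (x : D) : 0 < psi x := lt_le_trans ltr01 (psi_ge1 x).

Lemma psi_norm_le f (r : \bar R) :
  (forall x, (((psi x)^-1 * `|f x|)%:E <= r)%E) -> (psi_norm f <= r)%E.
Proof. by move=> H; apply: ge_ereal_sup => _ [x _ <-]. Qed.

Lemma psi_norm_ub f x : (((psi x)^-1 * `|f x|)%:E <= psi_norm f)%E.
Proof. by apply: ereal_sup_ubound; exists x. Qed.

Lemma psi_norm_ge0 f : (0 <= psi_norm f)%E.
Proof.
apply: le_trans (psi_norm_ub f (SigSub (mem_set D0))).
by rewrite lee_fin mulr_ge0 // invr_ge0 ltW.
Qed.

Lemma psi_normD f g : (psi_norm (f + g)%R <= psi_norm f + psi_norm g)%E.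
Proof.
apply: psi_norm_le => x.
apply: le_trans (leeD (psi_norm_ub f x) (psi_norm_ub g x)).
rewrite -EFinD lee_fin -mulrDr ler_wpM2l ?ler_normD //.
by rewrite invr_ge0 ltW.
Qed.

Lemma psi_normZ (a : R) f : psi_norm (a *: f) = (`|a|%:E * psi_norm f)%E.
Proof.
rewrite /Defs.psi_norm -ereal_supZl //; last first.
  pose x0 : D := SigSub (mem_set D0).
  by apply/set0P; exists ((psi x0)^-1 * `|f x0|)%:E, x0.
congr ereal_sup; apply/seteqP; split=> [_ [x _ <-]|_ [_ [x _ <-] <-]].
  exists ((psi x)^-1 * `|f x|)%:E; first by exists x.
  by rewrite -EFinM /= normrM mulrCA.
by exists x => //; rewrite -EFinM /= normrM mulrCA.
Qed.

Lemma psi_norm_bounded g (M : R) :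
  (forall x, `|g x| <= M) -> (psi_norm g <= M%:E)%E.
Proof.
move=> gM; apply: psi_norm_le => x; rewrite lee_fin (le_trans _ (gM x)) //.
by rewrite ler_piMl // invf_le1 // psi_ge1.
Qed.

Lemma Bpsi_normed_subspace : normed_subspace psi_norm Bpsi.
Proof.
split=> [a f1 f2 Bf1 Bf2||f Bf|f g _ _|a f _|f _ f0].
- move=> e e0; have e1 : 0 < e / (4 * (`|a| + 1)).
    by rewrite divr_gt0 // mulr_gt0 // ltr_wpDl.
  have [g1 [[M1 gM1] cg1 fg1]] := Bf1 _ e1.
  have [g2 [[M2 gM2] cg2 fg2]] := Bf2 (e / 2) ltac:(lra).
  exists (a *: g1 + g2); split.
  + exists (`|a| * M1 + M2) => x /=; rewrite (le_trans (ler_normD _ _)) //.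
    by rewrite lerD // normrM ler_wpM2l.
  + by move=> x; apply: cvgD (cg2 x); apply: cvgM (cg1 x); exact: cvg_cst.
  + have -> : a *: f1 + f2 - (a *: g1 + g2) = a *: (f1 - g1) + (f2 - g2).
      by rewrite scalerBr opprD addrACA.
    apply: le_lt_trans (psi_normD _ _) _; rewrite psi_normZ.
    (* The non-strict bound is 3/4 e, which leaves room for the strict one. *)
    apply: (@le_lt_trans _ _ (`|a| * (e / (4 * (`|a| + 1))) + e / 2)%:E).
      rewrite EFinD EFinM; apply: leeD; last exact: ltW.
      by rewrite lee_wpmul2l ?lee_fin // ltW.
    have -> : `|a| * (e / (4 * (`|a| + 1))) = `|a| / (`|a| + 1) * (e / 4).
      by field; rewrite gt_eqF // ltr_wpDl.
    have : `|a| / (`|a| + 1) * (e / 4) <= e / 4.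
      rewrite ler_piMl //; first by lra.
      by rewrite ler_pdivrMr ?mul1r ?lerDl // ltr_wpDl.
    by rewrite lte_fin; lra.
- move=> e e0; exists 0; split; first by exists 0 => x; rewrite normr0.
  + by move=> x; exact: (@cst_continuous _ _ (0 : R) x).
  + rewrite subrr (le_lt_trans (psi_norm_bounded (M := 0) _)) // => x.
    by rewrite normr0.
- have [g [[M gM] _ fg]] := Bf 1 ltr01.
  rewrite ge0_fin_numE ?psi_norm_ge0 // -[f](subrK g).
  apply: le_lt_trans (psi_normD _ _) _.
  apply: le_lt_trans (leeD (ltW fg) (psi_norm_bounded gM)) _.
  by rewrite -EFinD ltry.
- exact: psi_normD.
- exact: psi_normZ.
- apply/funext => x; apply/eqP; rewrite -normr_eq0 eq_le normr_ge0 andbT.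
  have := psi_norm_ub f x; rewrite f0 lee_fin pmulr_rle0 //.
  by rewrite invr_gt0.
Qed.

End WeightedNorm.

Theorem corollary7p10
  (R : realType)
  (* separable real Hilbert space *)
  (X : completeNormedModType R)
  (dot : {dot X for (@idfun R)})
  (dotE : forall x : X, `|x| ^+ 2 = dot x x)
  (sepX : separable_space X)
  (* the operator A and the semigroup S t = e^(tA) *)
  (A : X -> X) (domA : set X) (S : R -> X -> X) (c : R)
  (S_c0 : c0_semigroup (@enorm R X) setT S)
  (S_growth : growth_bound (@enorm R X) setT S c)
  (S_gen : generates A domA S)
  (A_res : compact_resolvent A domA)
  (* coefficients *)
  (m : nat) (m_ge1 : (1 <= m)%N)
  (d : nat)
  (alpha : X -> X) (sigma : 'I_d -> X -> X)
  (alpha_lip : forall l, (l <= m)%N -> lipschitz_domn A domA l alpha)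
  (sigma_lip : forall j l, (l <= m)%N -> lipschitz_domn A domA l (sigma j))
  (sigma_C1 : forall j, C1_bounded_derivative (sigma j))
  (* Brownian motion *)
  (dd : measure_display) (Omega : measurableType dd)
  (P : probability Omega R) (F : R -> set (set Omega))
  (F_filt : filtration F)
  (W : 'I_d -> R -> Omega -> R) (W_bm : brownian_motion P F W)
  (* solutions of the full equation and of the split equations *)
  (x : R -> X -> Omega -> X)
  (x_sol : mild_solution P F W S alpha sigma x)
  (z0 : R -> X -> X)
  (z0_sol : mild_ode_solution S (strat_drift alpha sigma) z0)
  (z : 'I_d -> R -> X -> Omega -> X)
  (z_sol : forall j, stratonovich_solution P F (W j) (sigma j) (z j))
  (* weighted space and standing assumption *)
  (l0 : nat) (l0_lt : (l0 < m)%N) (s0 : R) (s0_ge2 : 2 <= s0)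
  (nrm := @psi_norm R X A domA l0 s0) (E := @Bpsi R X A domA l0 s0)
  (Pt := @transition R dd Omega P X A domA l0 x)
  (Pj := fun j : 'I_d.+1 =>
     @transition R dd Omega P X A domA l0 (split_flow z0 z j))
  (Pt_c0 : c0_semigroup nrm E Pt)
  (omega : R) (Pt_growth : growth_bound nrm E Pt omega)
  (Pj_c0 : forall j, c0_semigroup nrm E (Pj j))
  (omegaj : 'I_d.+1 -> R)
  (Pj_growth : forall j, growth_bound nrm E (Pj j) (omegaj j))
  (T : R) (T_gt0 : 0 < T)
  (f : set_type (domn A domA l0) -> R)
  (fM : MTEuler nrm E Pt Pj T f) :
  exists C : R, forall (n : nat) (dt : R), 0 < dt -> n%:R * dt <= T ->
    (nrm (Pt (n%:R * dt) f - iter n (euler_splitting Pj dt) f)%R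
       <= (C * dt)%:E)%E.
Proof.
have nE : normed_subspace nrm E.
apply: (Bpsi_normed_subspace (domn0 (l := l0) S_c0 S_gen)).
  exact: le_trans s0_ge2.
exact: (euler_splitting_error nE Pt_c0 Pj_c0 Pt_growth Pj_growth T_gt0 fM).
Qed.
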